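(* Let $X$ and $Y$ be real locally convex topological vector spaces and let $F\colon X\rightrightarrows Y$ be a quasi-nearly convex set-valued mapping. Then $$\operatorname{qri}(\operatorname{gph}(F))\supset\{(x,y)\in X\times Y\mid x\in\operatorname{qri}(\operatorname{dom}(F)),\ y\in\operatorname{int}(F(x))\}.$$ If in addition $\operatorname{gph}(F)$ is quasi-regular, and $F(x)$ is convex with $\operatorname{int}(F(x))\neq\emptyset$ for every $x\in\operatorname{dom}(F)$, then $$\operatorname{qri}(\operatorname{gph}(F))=\{(x,y)\in X\times Y\mid x\in\operatorname{qri}(\operatorname{dom}(F)),\ y\in\operatorname{int}(F(x))\}.$$
   Context: For a set-valued mapping $F\colon X\rightrightarrows Y$: $\operatorname{dom}(F)=\{x\mid F(x)\neq\emptyset\}$, $\operatorname{gph}(F)=\{(x,y)\in X\times Y\mid y\in F(x)\}$. $\operatorname{int}$ denotes topological interior. For a subset $\Omega$ of a topological vector space $Z$ (not necessarily convex), $\operatorname{cone}(\Omega)=\{\lambda w\mid\lambda\ge0,\ w\in\Omega\}$ and $\overline{\operatorname{cone}}(\Omega)$ is its closure. Define: intrinsic relative interior $\operatorname{iri}(\Omega)=\{z\in\Omega\mid\operatorname{cone}(\Omega-z)\text{ is a linear subspace of }Z\}$; quasi-relative interior $\operatorname{qri}(\Omega)=\{z\in\Omega\mid\overline{\operatorname{cone}}(\Omega-z)\text{ is a linear subspace of }Z\}$. $\Omega$ is quasi-regular if $\operatorname{qri}(\Omega)=\operatorname{iri}(\Omega)$. A nonempty set $\Omega\subset Z$ is quasi-nearly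 convex if there is a convex set $C\subset Z$ with $\operatorname{qri}(C)\neq\emptyset$ and $C\subset\Omega\subset\overline{C}$. The mapping $F$ is quasi-nearly convex if $\operatorname{gph}(F)$ is a quasi-nearly convex set in $X\times Y$. *)

(* Defs.v *)
From HB Require Import structures.
From mathcomp Require Import all_boot all_order all_algebra.
From mathcomp Require Import all_classical all_reals all_analysis.

Set Implicit Arguments.
Unset Strict Implicit.
Unset Printing Implicit Defensive.

Import Order.TTheory GRing.Theory Num.Theory.

Local Open Scope classical_set_scope.
Local Open Scope ring_scope.

Definition dom (T U : Type) (F : T -> set U) : set T := [set x | F x !=set0].

Definition gph (T U : Type) (F : T -> set U) : set (T * U) :=
  [set z | F z.1 z.2].

(* No convexity is built in: this is the set of nonnegative multiples of points
   of A, not the convex cone generated by A. *)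
Definition cone (R : realType) (Z : lmodType R) (A : set Z) : set Z :=
  [set z | exists2 l : R, 0 <= l & exists2 w : Z, A w & z = l *: w].

Definition linear_subspace (R : realType) (Z : lmodType R) (A : set Z) : Prop :=
  submod_closed [in A].

Definition shift_set (R : realType) (Z : lmodType R) (A : set Z) (z : Z) :
  set Z := [set w - z | w in A].

Definition iri (R : realType) (Z : lmodType R) (A : set Z) : set Z :=
  [set z | A z /\ linear_subspace (cone (shift_set A z))].

Definition qri (R : realType) (Z : topologicalLmodType R) (A : set Z) : set Z :=
  [set z | A z /\ linear_subspace (closure (cone (shift_set A z)))].

Definition quasi_regular (R : realType) (Z : topologicalLmodType R)
  (A : set Z) : Prop := qri A = iri A.

Definition quasi_nearly_convex (R : realType) (Z : topologicalLmodType R)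
  (A : set Z) : Prop :=
  A !=set0 /\
  exists C : set Z,
    [/\ convex_set C, qri C !=set0, C `<=` A & A `<=` closure C].

Definition quasi_nearly_convex_map (R : realType) (X Y : tvsType R)
  (F : X -> set Y) : Prop := quasi_nearly_convex (gph F).

(* Main.v *)
Require Import Defs.
From HB Require Import structures.
From mathcomp Require Import all_boot all_order all_algebra.
From mathcomp Require Import all_classical all_reals all_analysis.

(**
Fix z = (x, y) in the graph of F and let K be the closure of
cone (gph F - z).

The inclusion into qri (gph F). Near convexity enters only through one fact:
if C is convex and C <= gph F <= closure C, then K is also the closure of
cone (C - z), because w |-> l (w - z) maps closure C into that closure. Hence
K is a closed convex cone ([quasi_nearly_convex_coneD]), although cone
(gph F - z) itself need not be closed under sums. If y is interior to F x,
then F x - y absorbs Y, so K contains the whole vertical space {0} x Y.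
Adding vertical vectors, K contains (a, 0) for every a in cone (dom F - x),
hence M x {0} for M the closure of that cone; and the first projection maps K
into M. So K is M x Y, which is a subspace as soon as M is, that is, when x is
in qri (dom F) ([qri_gph_supset]).

The reverse inclusion. Quasi-regularity upgrades the hypothesis: the cone L of
gph F - z is a subspace before any closure is taken. Its first projection is
exactly cone (dom F - x), which is therefore a subspace, and so is its
closure. For the second coordinate, take y0 interior to F x. The vertical
vector (0, y0 - y) lies in L, hence so does its opposite; this says that
y = y0 or that the segment from y0 to y can be prolonged within F x up to some
w with w - y a positive multiple of y - y0. In the latter case y is a convex
combination of y0 and w in which y0 has positive weight, and a convex set
contains every such point in its interior
([convex_interior_segment], [iri_gph_subset]).
*)

Set Implicit Arguments.
Unset Strict Implicit.
Unset Printing Implicit Defensive.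

Import Order.TTheory GRing.Theory Num.Theory.
Import numFieldTopology.Exports.

Local Open Scope classical_set_scope.
Local Open Scope ring_scope.

(** * Subspaces, convexity and cones *)

Lemma linear_subspaceP (R : realType) (Z : lmodType R) (A : set Z) :
  linear_subspace A <->
  A 0 /\ forall (a : R) u v, A u -> A v -> A (a *: u + v).
Proof.
split=> [[A0 AL]|[A0 AL]].
  split=> [|a u v Au Av]; first by rewrite inE in A0.
  by have := AL a u v; rewrite !inE; apply.
split=> [|a u v]; first by rewrite inE.
by rewrite !inE; exact: AL.
Qed.

Lemma linear_subspaceN (R : realType) (Z : lmodType R) (A : set Z) u :
  linear_subspace A -> A u -> A (- u).
Proof.
by move=> /linear_subspaceP[A0 AL] Au; rewrite -[- u]addr0 -scaleN1r; exact: AL.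
Qed.

Lemma linear_subspace_addN (R : realType) (Z : lmodType R) (A : set Z) :
  A 0 -> (forall u v, A u -> A v -> A (u + v)) ->
  (forall l u, 0 <= l -> A u -> A (l *: u)) ->
  (forall u, A u -> A (- u)) -> linear_subspace A.
Proof.
move=> A0 AD AZ AN; apply/linear_subspaceP; split=> // a u v Au Av.
apply: AD => //; have [a0|a0] := leP 0 a; first exact: AZ.
rewrite -[a]opprK scaleNr -scalerN.
by apply: AZ; [rewrite oppr_ge0 ltW|exact: AN].
Qed.

Lemma convex_setP (R : realType) (Z : lmodType R) (A : set Z) :
  convex_set A <->
  forall (k : R) x y, 0 <= k -> k <= 1 -> A x -> A y ->
    A (k *: x + (1 - k) *: y).
Proof.
split=> [cA k x y k0 k1 Ax Ay|cA x y k].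
  by have := cA x y (Itv01 k0 k1); rewrite !inE => /(_ Ax Ay).
by rewrite !inE; exact: cA.
Qed.

Lemma cone_shiftP (R : realType) (Z : lmodType R) (A : set Z) z u :
  cone (shift_set A z) u <->
  exists l : R, exists w, [/\ 0 <= l, A w & u = l *: (w - z)].
Proof.
split=> [[l l0 [_ [w Aw <-] ->]]|[l [w [l0 Aw ->]]]]; first by exists l, w.
by exists l => //; exists (w - z) => //; exists w.
Qed.

Lemma cone_ge0Z (R : realType) (Z : lmodType R) (A : set Z) (l : R) u :
  0 <= l -> cone A u -> cone A (l *: u).
Proof.
move=> l0 [m m0 [w Aw ->]]; exists (l * m); first exact: mulr_ge0.
by exists w => //; rewrite scalerA.
Qed.

(** If l + m > 0, the sum l (w - z) + m (x - z) equals (l + m) (c - z), where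
    c is the convex combination of w and x with weights l / (l + m) and
    m / (l + m). *)
Lemma cone_convexD (R : realType) (Z : lmodType R) (A : set Z) z u v :
  convex_set A -> cone (shift_set A z) u -> cone (shift_set A z) v ->
  cone (shift_set A z) (u + v).
Proof.
move=> /convex_setP cA /cone_shiftP[l [w [l0 Aw ->]]].
move=> /cone_shiftP[m [x [m0 Ax ->]]]; apply/cone_shiftP.
have lm0 : 0 <= l + m by exact: addr_ge0.
have [lm|lmN0] := eqVneq (l + m) 0.
  move: lm => /eqP; rewrite paddr_eq0// => /andP[/eqP -> /eqP ->].
  by exists 0, w; split=> //; rewrite !scale0r addr0.
exists (l + m), (l / (l + m) *: w + (1 - l / (l + m)) *: x); split=> //.
  apply: cA => //; first exact: divr_ge0.
  by rewrite ler_pdivrMr ?mul1r ?lerDl// lt_neqAle eq_sym lmN0.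
rewrite !scalerBr scalerDr !scalerA mulrBr mulr1 mulrCA divff// mulr1.
by rewrite [l + m - l]addrC addKr scalerDl opprD addrACA.
Qed.

(** * Closures in topological vector spaces *)

Lemma closure_image (T U : topologicalType) (f : T -> U) (A : set T)
    (B : set U) x :
  {for x, continuous f} -> (forall a, A a -> B (f a)) ->
  closure A x -> closure B (f x).
Proof.
by move=> fx AB clA V /fx /clA [a [Aa Va]]; exists (f a); split=> //; exact: AB.
Qed.

Lemma closure_idem (T : topologicalType) (A : set T) :
  closure (closure A) = closure A.
Proof. by rewrite -(closure_id _).1//; exact: closed_closure. Qed.

Lemma affine_continuous (R : realType) (Z : topologicalLmodType R)
    (T : topologicalType) (b : Z) (f : T -> R^o) (g : T -> Z) :
  continuous f -> continuous g -> continuous (fun t => b + f t *: g t).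
Proof.
move=> fc gc t; apply: (continuous2_cvg _ (h := fun u v : Z => u + v)).
- exact: (@add_continuous Z (_, _)).
- exact: cvg_cst.
apply: (continuous2_cvg _ (h := fun (u : R^o) (v : Z) => u *: v)).
- exact: (@scale_continuous R Z (_, _)).
- exact: fc.
- exact: gc.
Qed.

Lemma translation_continuous (R : realType) (Z : topologicalLmodType R)
    (b : Z) : continuous (fun u => b + u).
Proof.
rewrite (_ : (fun u => _) = (fun u => b + (1 : R^o) *: u)).
  by apply: affine_continuous => u; [exact: cvg_cst|exact: cvg_id].
by apply/funext => u; rewrite scale1r.
Qed.

Lemma dilation_continuous (R : realType) (Z : topologicalLmodType R)
    (k : R) : continuous (fun u : Z => k *: u).
Proof.
rewrite (_ : (fun u => _) = (fun u => 0 + (k : R^o) *: u)).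
  by apply: affine_continuous => u; [exact: cvg_cst|exact: cvg_id].
by apply/funext => u; rewrite add0r.
Qed.

Lemma dilation_translation_continuous (R : realType)
    (Z : topologicalLmodType R) (k : R) (b : Z) :
  continuous (fun u => k *: (b + u)).
Proof.
move=> u; apply: (@continuous_comp _ _ _ (fun u => b + u) (fun u => k *: u)).
  exact: translation_continuous.
exact: dilation_continuous.
Qed.

(** Translations are continuous, so one summand can move at a time: [v] reaches
    the closure while the other summand stays in [A]; then the latter moves,
    and the sum lands in the closure of the closure. *)
Lemma closureD (R : realType) (Z : topologicalLmodType R) (A : set Z) :
  (forall u v, A u -> A v -> A (u + v)) ->
  forall u v, closure A u -> closure A v -> closure A (u + v).
Proof.
move=> AD u v Au Av; rewrite -closure_idem [u + v]addrC.
apply: (closure_image (f := fun w => v + w)) Au => [|a Aa].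
  exact: translation_continuous.
rewrite addrC; apply: (closure_image (f := fun w => a + w)) Av => [|b].
  exact: translation_continuous.
exact: AD.
Qed.

Lemma closureZ (R : realType) (Z : topologicalLmodType R) (A : set Z) (k : R) :
  (forall u, A u -> A (k *: u)) -> forall u, closure A u -> closure A (k *: u).
Proof.
move=> Ak u; apply: (closure_image (f := fun w => k *: w)) => //.
exact: dilation_continuous.
Qed.

Lemma closure_linear_subspace (R : realType) (Z : topologicalLmodType R)
  (A : set Z) : linear_subspace A -> linear_subspace (closure A).
Proof.
move=> /linear_subspaceP[A0 AL]; apply/linear_subspaceP.
split=> [|a u v Au Av]; first exact: subset_closure.
apply: closureD => // [x y Ax Ay|]; first by rewrite -[x]scale1r; exact: AL.
by apply: closureZ Au => x Ax; rewrite -[_ *: _]addr0; exact: AL.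
Qed.

(** The continuous map w |-> l (w - z) sends [C] into the smaller cone, hence
    [closure C], and a fortiori [A], into its closure. *)
Lemma closure_cone_shift_dense (R : realType) (Z : topologicalLmodType R)
    (C A : set Z) z :
  C `<=` A -> A `<=` closure C ->
  closure (cone (shift_set A z)) = closure (cone (shift_set C z)).
Proof.
move=> CsubA AsubC; rewrite eqEsubset; split; last first.
  apply: closureS => u /cone_shiftP[l [w [l0 Cw ->]]].
  by apply/cone_shiftP; exists l, w; split=> //; exact: CsubA.
rewrite -[X in _ `<=` X]closure_idem; apply: closureS.
move=> u /cone_shiftP[l [w [l0 /AsubC Cw ->]]]; rewrite addrC.
apply: (closure_image (f := fun w => l *: (- z + w))) Cw => [|c Cc].
  exact: dilation_translation_continuous.
by apply/cone_shiftP; exists l, c; rewrite addrC.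
Qed.

(** The closed cone of [A] at [z] is the one of the convex set that
    approximates [A], and the latter is closed under sums. *)
Lemma quasi_nearly_convex_coneD (R : realType) (Z : topologicalLmodType R)
    (A : set Z) z :
  quasi_nearly_convex A ->
  forall u v, closure (cone (shift_set A z)) u ->
    closure (cone (shift_set A z)) v -> closure (cone (shift_set A z)) (u + v).
Proof.
move=> [_ [C [cC _ CsubA AsubC]]].
rewrite (closure_cone_shift_dense z CsubA AsubC).
by apply: closureD => u v; exact: cone_convexD.
Qed.

(** * Interior points *)

Lemma interior_absorbing (R : realType) (Z : topologicalLmodType R)
    (A : set Z) x v :
  A° x -> exists2 t : R, 0 < t & A (x + t *: v).
Proof.
move=> Ax; have lc : continuous (fun t : R^o => x + t *: v).
  by apply: affine_continuous => t; [exact: cvg_id|exact: cvg_cst].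
have : nbhs (0 : R^o) [set t | A (x + t *: v)].
  by apply: lc; rewrite scale0r addr0.
move=> /nbhs_ballP[e /= e0 eA]; exists (e / 2); first exact: divr_gt0.
apply: eA; rewrite /ball/= sub0r normrN gtr0_norm ?divr_gt0//.
by rewrite gtr_pMr// invf_lt1// ltr1n.
Qed.

(** The homothety of center [w] and ratio k^-1 is continuous and sends the
    point of the segment to [x]; so it sends nearby points into [A], and they
    are themselves convex combinations of these images and [w]. *)
Lemma convex_interior_segment (R : realType) (Z : topologicalLmodType R)
    (A : set Z) x w (k : R) :
  convex_set A -> A° x -> A w -> 0 < k -> k <= 1 ->
  A° (k *: x + (1 - k) *: w).
Proof.
move=> /convex_setP cA Ax Aw k0 k1.
pose h y := k^-1 *: (- ((1 - k) *: w) + y).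
have hc : continuous h by exact: dilation_translation_continuous.
have hK y : k *: h y + (1 - k) *: w = y.
  by rewrite /h scalerA divff ?gt_eqF// scale1r addrAC addNr add0r.
have hx : h (k *: x + (1 - k) *: w) = x.
  by rewrite /h addrCA addNr addr0 scalerA mulVf ?gt_eqF// scale1r.
have : nbhs (k *: x + (1 - k) *: w) (h @^-1` A) by apply: hc; rewrite hx.
apply: filterS => y Ahy; rewrite -(hK y); apply: cA => //; exact: ltW.
Qed.

(** * Relative interiors of graphs *)

Lemma fst_cone_gph (R : realType) (X Y : lmodType R) (F : X -> set Y)
    (z : X * Y) :
  fst @` cone (shift_set (gph F) z) = cone (shift_set (dom F) z.1).
Proof.
rewrite eqEsubset; split=> [_ [_ /cone_shiftP[l [w [l0 Fw ->]]] <-]|].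
  by apply/cone_shiftP; exists l, w.1; split=> //; exists w.2.
move=> _ /cone_shiftP[l [a [l0 [b Fab] ->]]].
exists (l *: ((a, b) - z)) => //; apply/cone_shiftP.
by exists l, (a, b).
Qed.

(** The closed cone of the graph at [(x, y)] is the product of the closed cone
    of the domain at [x] and the whole of [Y]. *)
Lemma qri_gph_supset (R : realType) (X Y : tvsType R) (F : X -> set Y) :
  quasi_nearly_convex_map F ->
  [set z : X * Y | qri (dom F) z.1 /\ (F z.1)° z.2] `<=` qri (gph F).
Proof.
move=> Fc [x y] /= [[_ Msub] Fy].
have Fxy : F x y by exact: nbhs_singleton Fy.
split=> //; set K := closure _.
set M := closure (cone (shift_set (dom F) x)) in Msub.
have KD : forall u v, K u -> K v -> K (u + v).
  exact: quasi_nearly_convex_coneD.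
have KZ l u : 0 <= l -> K u -> K (l *: u).
  by move=> l0; apply: closureZ => v; exact: cone_ge0Z.
(* Since [F x - y] absorbs [v], the cone contains the vertical vector. *)
have Kvert v : K (0, v).
  have [t t0 Ft] := interior_absorbing v Fy; apply: subset_closure.
  apply/cone_shiftP; exists t^-1, (x, y + t *: v); split=> //.
    by rewrite invr_ge0 ltW.
  congr pair => /=; rewrite ?subrr ?scaler0//.
  by rewrite addrAC subrr add0r scalerA mulVf ?gt_eqF// scale1r.
have KM u : K u -> M u.1.
  apply: closure_image => [|p Kp]; first exact: cvg_fst.
  by rewrite -[x]/(x, y).1 -fst_cone_gph; exists p.
have MK u : M u -> K (u, 0).
  rewrite /K -closure_idem.
  apply: (closure_image (f := fun u => (u, 0 : Y))) => [|a].
    by apply: cvg_pair; [exact: cvg_id|exact: cvg_cst].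
  rewrite -[x]/(x, y).1 -fst_cone_gph => -[[a' b] Kab /= <-].
  have -> : (a', 0) = (a', b) + (0, - b) :> X * Y.
    by congr pair => /=; rewrite ?addr0 ?subrr.
  by apply: KD; [exact: subset_closure|exact: Kvert].
apply: linear_subspace_addN; [exact: Kvert|exact: KD|exact: KZ|].
move=> [u v] /KM /= Mu.
have -> : - (u, v) = (- u, 0) + (0, - v) :> X * Y.
  by apply: injective_projections; rewrite /= ?addr0 ?add0r.
by apply: KD; [exact: MK (linear_subspaceN Msub Mu)|exact: Kvert].
Qed.

(** Opposites in the cone of the graph allow the segment from an interior
    point of [F x] to [y] to be prolonged inside [F x]. *)
Lemma iri_gph_subset (R : realType) (X Y : tvsType R) (F : X -> set Y) :
  (forall x, dom F x -> convex_set (F x) /\ (F x)° !=set0) ->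
  iri (gph F) `<=` [set z : X * Y | qri (dom F) z.1 /\ (F z.1)° z.2].
Proof.
move=> Fc [x y] /= [Fxy Lsub]; have Dx : dom F x by exists y.
split.
  split=> //; apply: closure_linear_subspace.
  rewrite -[x]/(x, y).1 -fst_cone_gph.
  move/linear_subspaceP : Lsub => [L0 LL]; apply/linear_subspaceP.
  split; first by exists 0.
  by move=> a _ _ [p Lp <-] [q Lq <-]; exists (a *: p + q) => //; exact: LL.
have [cFx [y0 Fy0]] := Fc _ Dx.
have : cone (shift_set (gph F) (x, y)) (0, y0 - y).
  apply/cone_shiftP; exists 1, (x, y0); split=> //; last first.
    by rewrite scale1r; congr pair => /=; rewrite subrr.
  exact: nbhs_singleton Fy0.
move=> /(linear_subspaceN Lsub) /cone_shiftP[l [[a w] [l0 Faw]]].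
move=> [/eqP]; rewrite oppr0 eq_sym scaler_eq0 => + /= yy0.
(* A zero multiplier means that the chosen interior point is [y] itself. *)
have [l00 _|lN0 /=] := eqVneq l 0.
  move: yy0; rewrite l00 scale0r => /eqP; rewrite oppr_eq0 subr_eq0 => /eqP <-.
  exact: Fy0.
rewrite subr_eq0 => /eqP ax; rewrite ax in Faw.
have l10 : 0 < 1 + l by rewrite ltr_pwDl.
(* Solve [- (y0 - y) = l *: (w - y)] for [y]. *)
have -> : y = (1 + l)^-1 *: y0 + (1 - (1 + l)^-1) *: w.
  apply: (scalerI (lt0r_neq0 l10)).
  rewrite scalerDr !scalerA mulrBr divff ?gt_eqF// mulr1 scale1r [1 + l]addrC.
  rewrite addrK scalerDl scale1r.
  have -> : l *: w = l *: (w - y) + l *: y by rewrite -scalerDr subrK.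
  by rewrite -yy0 opprB addrA [y0 + _]addrC subrK addrC.
apply: convex_interior_segment => //; first by rewrite invr_gt0.
by rewrite invf_le1// lerDl.
Qed.

Theorem theorem6p3 (R : realType) (X Y : tvsType R) (F : X -> set Y)
    (F_qnc : quasi_nearly_convex_map F) :
  [set z : X * Y | qri (dom F) z.1 /\ (F z.1)° z.2] `<=` qri (gph F) /\
  (quasi_regular (gph F) ->
   (forall x : X, dom F x -> convex_set (F x) /\ (F x)° !=set0) ->
   qri (gph F) = [set z : X * Y | qri (dom F) z.1 /\ (F z.1)° z.2]).
Proof.
split=> [|Freg Fint]; first exact: qri_gph_supset.
rewrite eqEsubset; split; last exact: qri_gph_supset.
rewrite Freg; exact: iri_gph_subset.
Qed.
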